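(* Let $\{S(t): t\ge 0\}$ be an asymptotically closed semigroup on a complete metric space $(V,d)$ and let $T>0$. Then the following statements are equivalent: (1) There exists a $T$-discrete exponential attractor $\mathbf{M_0}$ in $V$ for the semigroup. (2) There exists a nonempty bounded absorbing set $\mathbf{B}\subseteq V$ for the semigroup such that the covering condition $$N^{V}(S(kT)\mathbf{B},aq^{k})\le b h^{k},\quad k\in\mathbb{N},\ k\ge k_0,$$ holds for some $k_0\in\mathbb{N}$, $a,b>0$, $q\in(0,1)$ and $h\ge 1$. Moreover, if the covering condition in (2) holds (for a nonempty bounded absorbing set $\mathbf{B}$ and such constants $k_0,a,b,q,h$), then there is a countable subset $\mathbf{E_0}$ of $\mathbf{B}$ such that $\mathbf{A}=\Lambda^{V}(\mathrm{cl}_V\mathbf{E_0})$ is the global attractor for the semigroup and $$\mathbf{M_0}=\mathbf{A}\cup\mathbf{E_0}=\mathrm{cl}_{V}\mathbf{E_0}\subseteq \mathbf{B}$$ is a $T$-discrete exponential attractor with rate of attraction $\xi\in(0,\frac{1}{T}\ln\frac{1}{q})$, whose fractal dimension is bounded by $$\dim_f^{V}(\mathbf{M_0})\le\log_{\frac{1}{q}}h.$$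
   Context: $\mathbb{N}=\{1,2,\dots\}$, $\mathbb{N}_0=\mathbb{N}\cup\{0\}$. A semigroup $\{S(t):t\ge0\}$ on a metric space $(V,d)$ is a family of maps $S(t):V\to V$ with $S(t)S(s)=S(t+s)$ for $t,s\ge 0$ and $S(0)=I$ the identity; ''$t\ge 0$'' means throughout either $t\in[0,\infty)$ or $t\in\mathbb{N}_0$ (and $T$ belongs to the time set). Asymptotically closed: for any $t\ge 0$, $t_k\ge 0$ with $t_k\to\infty$ and any bounded sequence $x_k\in V$, if $S(t_k)x_k\to x$ and $S(t+t_k)x_k\to y$ with $x,y\in V$, then $S(t)x=y$. Absorbing set: $\mathbf{B}\subseteq V$ such that for every bounded $G\subseteq V$ there is $t_G\ge 0$ with $S(t)G\subseteq\mathbf{B}$ for all $t\ge t_G$. $\mathrm{dist}^V(G,H)=\sup_{x\in G}\inf_{y\in H}d(x,y)$; $\mathrm{cl}_V$ is closure in $V$; the $\omega$-limit set of $G\subseteq V$ is $\Lambda^V(G)=\bigcap_{s\ge 0}\mathrm{cl}_V\bigcup_{t\ge s}S(t)G$. Global attractor: a nonempty compact set $\mathbf{A}\subseteq V$ with $S(t)\mathbf{A}=\mathbf{A}$ for all $t\ge 0$ and $\lim_{t\to\infty}\mathrm{dist}^V(S(t)G,\mathbf{A})=0$ for every bounded $G\subseteq V$. $N^V(G,\varepsilon)$ is the minimal number of open $\varepsilon$-balls in $V$ centered at points of $G$ needed to cover $G\subseteq V$. The fractal dimension is $\dim_f^V(G)=\limsup_{\varepsilon\to0^+}\log_{1/\varepsilon}N^V(G,\varepsilon)$.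 $T$-discrete exponential attractor ($T>0$): a nonempty compact set $\mathbf{M_0}\subseteq V$ such that $S(T)\mathbf{M_0}\subseteq\mathbf{M_0}$, $\dim_f^V(\mathbf{M_0})<\infty$, and there is $\xi>0$ with $\lim_{t\to\infty}e^{\xi t}\mathrm{dist}^V(S(t)G,\mathbf{M_0})=0$ for every bounded $G\subseteq V$. ''With rate of attraction $\xi\in(0,\xi_0)$'' means that the last limit holds for every $\xi\in(0,\xi_0)$ and every bounded $G\subseteq V$. *)

(* Defs.v *)
From mathcomp Require Import all_boot all_order all_algebra.
From mathcomp Require Import all_classical all_reals all_analysis.

Set Implicit Arguments.
Unset Strict Implicit.
Unset Printing Implicit Defensive.

Import Order.TTheory GRing.Theory Num.Theory.
Import numFieldNormedType.Exports.

Local Open Scope classical_set_scope.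
Local Open Scope ring_scope.

Section Metric.
Context {R : realType} {V : metricType R}.
Implicit Types (G H : set V) (x y : V) (eps : R).

(* The library's complete (pseudo)metric structures carry a distinguished
   point and are not joined with metricType, so completeness is a predicate. *)
Definition complete_metric : Prop :=
  forall u : nat -> V, cauchy (u @ \oo) -> exists l : V, u @ \oo --> l.

Definition bounded_metric G : Prop :=
  exists M : R, forall x y, G x -> G y -> mdist x y <= M.

(* The supremum is taken in [0, +oo] (hence the extra point 0), so that
   dist(set0, H) = 0 instead of -oo. *)
Definition hdist G H : \bar R :=
  ereal_sup ([set 0%E] `|`
    [set ereal_inf [set (mdist x y)%:E | y in H] | x in G]).

(* +oo if G has no finite cover of the required form. *)
Definition covering_number G eps : \bar R :=
  ereal_inf [set (n%:R)%:E | n in [set n : nat |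
    exists c : 'I_n -> V, (forall i, G (c i)) /\
      G `<=` \bigcup_(i in [set: 'I_n]) ball (c i) eps]].

Definition elog (base : R) (z : \bar R) : \bar R :=
  (lne z * ((ln base)^-1)%:E)%E.

Definition fractal_dim G : \bar R :=
  limf_esup (fun eps => elog eps^-1 (covering_number G eps)) 0^'+.

End Metric.

Arguments complete_metric {R} V.

Section Semigroup.
Context {R : realType} {V : metricType R}.

Definition is_time_set (I : set R) : Prop :=
  I = [set t | 0 <= t] \/ I = range (fun n : nat => n%:R).

(* Throughout, I is the time set; the values of S outside I are irrelevant. *)
Variables (I : set R) (S : R -> V -> V).
Implicit Types (A B G M : set V).

Definition is_semigroup : Prop :=
  (forall x, S 0 x = x) /\
  (forall t s x, I t -> I s -> S t (S s x) = S (t + s) x).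

Definition asymptotically_closed : Prop :=
  forall (t : R) (tk : nat -> R) (xk : nat -> V) (x y : V),
    I t -> (forall k, I (tk k)) -> tk @ \oo --> +oo ->
    bounded_metric (range xk) ->
    S (tk k) (xk k) @[k --> \oo] --> x ->
    S (t + tk k) (xk k) @[k --> \oo] --> y ->
    S t x = y.

Definition absorbing B : Prop :=
  forall G, bounded_metric G ->
    exists2 tG, I tG & forall t, I t -> tG <= t -> S t @` G `<=` B.

Definition omega_limit G : set V :=
  \bigcap_(s in I) closure (\bigcup_(t in I `&` [set t | s <= t]) (S t @` G)).

Definition global_attractor A : Prop :=
  [/\ A !=set0,
      compact A,
      forall t, I t -> S t @` A = A &
      forall G, bounded_metric G ->
        hdist (S t @` G) A @[t --> within I +oo] --> 0%E].

Definition exp_attracts (xi : R) M : Prop :=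
  forall G, bounded_metric G ->
    ((expR (xi * t))%:E * hdist (S t @` G) M)%E @[t --> within I +oo] --> 0%E.

Definition discrete_exp_attractor (T : R) M : Prop :=
  [/\ M !=set0,
      compact M,
      S T @` M `<=` M,
      (fractal_dim M < +oo)%E &
      exists2 xi : R, 0 < xi & exp_attracts xi M].

Definition exp_attracts_below (xi0 : R) M : Prop :=
  forall xi : R, 0 < xi < xi0 -> exp_attracts xi M.

Definition covering_condition (T : R) B (k0 : nat) (a b q h : R) : Prop :=
  forall k : nat, (k0 <= k)%N ->
    (covering_number (S (k%:R * T) @` B) (a * q ^+ k) <= (b * h ^+ k)%:E)%E.

End Semigroup.

(* Main.v *)
(* (2) => (1): let [W k] be a finite net of [S(kT) B] of radius [a q^k] with
   centers in [S(kT) B], and let [E (n + 1)] be the union of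
   [W (k1 + n + 1)] and [S(T) (E n)]; then the union [E0] of the [E n] is
   positively invariant under [S(T)]. As [E n] is finite and contained in
   [S((k1 + n) T) B], for every [m] all but finitely many points of [E0] lie
   in [S(mT) B], which is covered by the balls around [W m]. Hence [E0] is
   totally bounded and its closure attracts bounded sets at the rate of
   [q^(t / T)]; and since the exceptional points are at most [C g^m] in
   number for any [g > h], its dimension is at most [log_(1/q) g]. The
   attractor is the omega-limit set of this compact attracting set; it lies
   in every [S(mT) B], so it is covered by the same balls.
   (1) => (2): [B] is the 1-neighbourhood of [M0], and a cover of [M0] by
   [q^k]-balls with [q = e^(- xi T)] yields one of [S(kT) B]. *)
Require Import Defs.
From mathcomp Require Import all_boot all_order all_algebra.
From mathcomp Require Import all_classical all_reals all_analysis.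
From mathcomp Require Import ring lra.
Import Order.TTheory GRing.Theory Num.Theory.
Import numFieldNormedType.Exports.
Local Open Scope classical_set_scope.
Local Open Scope ring_scope.

Set Implicit Arguments.
Unset Strict Implicit.
Unset Printing Implicit Defensive.

(** * Finite nets, semidistance and compactness in metric spaces *)

Section MetricSpace.
Context {R : realType} {V : metricType R}.
Implicit Types (G H K : set V) (x y : V) (e r : R) (s : seq V).

Lemma closure_mdistP G x :
  closure G x <-> forall e, 0 < e -> exists2 y, G y & mdist x y < e.
Proof.
split=> [Gx e e0|Gx B /nbhs_ballP[e /= e0 eB]].
  have [y [Gy]] := Gx _ (nbhsx_ballx x _ e0).
  by rewrite ballEmdist => xy; exists y.
have [y Gy xy] := Gx e e0.
by exists y; split => //; apply: eB; rewrite ballEmdist.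
Qed.

(** Unlike in [covering_number], the centers need not lie in [G], so a net of a set is also a net of
    its subsets. *)
Definition eps_net s e G := forall y, G y -> exists2 x, x \in s & mdist x y < e.

(** A finite bound rules out the empty infimum [+oo], and an infimum over a nonempty set of naturals
    is attained, so an optimal cover exists. *)
Lemma covering_number_le_net G e r : (covering_number G e <= r%:E)%E ->
  exists s, [/\ (size s)%:R <= r, {in s, forall x, G x} & eps_net s e G].
Proof.
rewrite /covering_number.
set P := [set n : nat | _] => hr.
have [[n0 Pn0]|n0] := pselect (exists n, P n); last first.
  have P0 : P = set0 by rewrite -subset0 => n Pn; apply: n0; exists n.
  by move: hr; rewrite P0 image_set0 ereal_inf0 leNgt ltey.
have [m [[c [Gc Gcov]] minm]] : exists m, P m /\ forall n, P n -> (m <= n)%N.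
  have ex : exists n, (fun n => `[< P n >]) n by exists n0; apply/asboolP.
  have [m /asboolP Pm minm] := ex_minnP ex.
  by exists m; split => // n /asboolP/minm.
exists (codom c); split.
- rewrite size_codom card_ord -lee_fin (le_trans _ hr)//.
  apply: le_ereal_inf_tmp => _ [n Pn <-].
  by rewrite lee_fin ler_nat minm.
- by move=> _ /codomP[i ->].
- move=> y /Gcov[i _]; rewrite ballEmdist => iy.
  by exists (c i) => //; exact: codom_f.
Qed.

Lemma covering_number_net_le s e G : {in s, forall x, G x} -> eps_net s e G ->
  (covering_number G e <= (size s)%:R%:E)%E.
Proof.
move=> sG snet; apply: ereal_inf_lbound; exists (size s) => //.
exists (fun i => tnth (in_tuple s) i); split.
  by move=> i; apply: sG; exact: mem_tnth.
move=> y /snet[x xs xy].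
have /tnthP[i xE] : x \in in_tuple s by [].
by exists i => //; rewrite ballEmdist /= -xE.
Qed.

Lemma hdist_le G H r : 0 <= r ->
  (forall x, G x -> exists2 y, H y & mdist x y <= r) ->
  (hdist G H <= r%:E)%E.
Proof.
move=> r0 GH; apply: ge_ereal_sup => _ [->|[x /GH[y Hy xy] <-]].
  by rewrite lee_fin.
apply: (@le_trans _ _ (mdist x y)%:E); last by rewrite lee_fin.
by apply: ereal_inf_lbound; exists y.
Qed.

Lemma hdist_ge0 G H : (0 <= hdist G H)%E.
Proof. by apply: ereal_sup_ubound; left. Qed.

Lemma hdist_lt G H r x : (hdist G H < r%:E)%E -> G x ->
  exists2 y, H y & mdist x y < r.
Proof.
move=> GHr Gx.
have : (ereal_inf [set (mdist x y)%:E | y in H] < r%:E)%E.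
  by apply: le_lt_trans GHr; apply: ereal_sup_ubound; right; exists x.
by move=> /ereal_inf_lt[_ [y Hy <-]]; rewrite lte_fin; exists y.
Qed.

(** Any cluster point of the image of the filter [\oo] under [u] serves; recurrence near it replaces
    an explicit subsequence. *)
Lemma compact_subseq K (u : nat -> V) : compact K -> (forall n, K (u n)) ->
  exists2 p, K p &
    forall e N, 0 < e -> exists2 n, (N <= n)%N & mdist p (u n) < e.
Proof.
move=> cK Ku.
have KF : (u @ \oo) K by exists 0%N => // n _; exact: Ku.
have [p [Kp clp]] := cK (u @ \oo) _ KF.
exists p => // e N e0.
have [|_ [[n Nn <-]]] :=
    clp (u @` [set n | (N <= n)%N]) _ _ (nbhsx_ballx p _ e0).
  by exists N => // n /= Nn; exists n.
by rewrite ballEmdist => pn; exists n.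
Qed.

(** Otherwise some [u n] in [K] is farther than [n] from [x0] for every [n], so late terms cannot
    return to within 1 of a cluster point. *)
Lemma compact_bounded_metric K : compact K -> bounded_metric K.
Proof.
move=> cK; have [->|/set0P[x0 Kx0]] := eqVneq K set0; first by exists 0.
suff [M KM] : exists M, forall x, K x -> mdist x0 x <= M.
  exists (M + M) => x y /KM xM /KM yM.
  by rewrite (le_trans (metric_triangle x x0 y))// lerD// metric_sym.
apply: contrapT => /forallNP noM.
have /choice[u Ku] (n : nat) : exists x, K x /\ n%:R < mdist x0 x.
  have /existsNP[x /not_implyP[Kx /negP]] := noM n%:R.
  by rewrite -ltNge; exists x.
have [p _ pu] := compact_subseq cK (fun n => (Ku n).1).
have [n nN] := pu 1 (Num.truncn (mdist x0 p + 1)).+1 ltr01.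
have := (Ku n).2; have := metric_triangle x0 p (u n).
have : mdist x0 p + 1 < (Num.truncn (mdist x0 p + 1)).+1%:R.
  by rewrite -truncn_lt_nat// addr_ge0// mdist_ge0.
have : ((Num.truncn (mdist x0 p + 1)).+1%:R <= n%:R :> R) by rewrite ler_nat.
lra.
Qed.

(** An ultrafilter containing a finite union contains one of its members. *)
Lemma ultra_net (F : set_system V) s e (FU : UltraFilter F) :
  F [set y | exists2 x, x \in s & mdist x y < e] ->
  exists x, F (ball x e).
Proof.
elim: s => [|x s IHs] Fs.
  have [y [z]] : exists y, exists2 x, x \in ([::] : seq V) & mdist x y < e.
    by have [y] := filter_ex Fs; exists y.
  by rewrite in_nil.
have [Fx|Fx] := in_ultra_setVsetC (ball x e) FU; first by exists x.
apply: IHs; apply: filterS2 Fs Fx => y [z]; rewrite inE => /orP[/eqP->|zs] zy.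
  by rewrite ballEmdist.
by move=> _; exists z.
Qed.

(** An ultrafilter on [K] contains a ball of radius [1 / (n + 1)] for each [n]. Any two of these
    balls meet, so their centers form a Cauchy sequence, and the ultrafilter converges to its
    limit. *)
Lemma totally_bounded_compact K : complete_metric V -> closed K ->
  (forall e, 0 < e -> exists s, eps_net s e K) -> compact K.
Proof.
move=> complV clK tbK; rewrite compact_ultra => F FU FK.
have /choice[c Fc] (n : nat) : exists x, F (ball x n.+1%:R^-1).
  have [|s snet] := tbK n.+1%:R^-1; first by rewrite invr_gt0.
  by apply: (ultra_net (s := s)); exact: filterS FK.
have cc m n : mdist (c m) (c n) < m.+1%:R^-1 + n.+1%:R^-1.
  have [y []] := filter_ex (filterI (Fc m) (Fc n)).
  rewrite !ballEmdist /= => my ny.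
  by rewrite (le_lt_trans (metric_triangle _ y _))// ltrD// metric_sym.
have near_inv e : 0 < e -> \forall n \near \oo, n.+1%:R^-1 < e.
  by move=> e0; exact: near_infty_natSinv_lt (PosNum e0).
have [l cl] : exists l : V, c @ \oo --> l.
  apply: complV; apply/cauchyP => e e0.
  have e20 : 0 < e / 2 by rewrite divr_gt0.
  have [N _ Ne] := near_inv _ e20.
  exists (c N); exists N => // n Nn; rewrite ballEmdist /=.
  rewrite (lt_le_trans (cc _ _))// [leRHS]splitr ltW// ltrD//.
    exact: Ne (leqnn N).
  exact: Ne.
have Fl : F --> l.
  apply/metricType_numDomainType.fcvgrPdist_lt => e e0.
  have e20 : 0 < e / 2 by rewrite divr_gt0.
  have cle := metricType_numDomainType.cvgr_dist_lt cl e20.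
  have [n [ne lcn]] := filter_ex (filterI (near_inv _ e20) (cle _)).
  apply: filterS (Fc n) => y; rewrite ballEmdist /= => cny.
  rewrite (le_lt_trans (metric_triangle _ (c n) _))// [ltRHS]splitr ltrD//.
  exact: lt_trans ne.
exists l; split => //.
by apply: clK => B Bl; exact: (@filter_ex _ F _ _ (filterI FK (Fl B Bl))).
Qed.

Lemma compact_closure_net G : complete_metric V ->
  (forall e, 0 < e -> exists s, eps_net s e G) -> compact (closure G).
Proof.
move=> complV tbG; apply: totally_bounded_compact => //.
  exact: closed_closure.
move=> e e0; have e20 : 0 < e / 2 by rewrite divr_gt0.
have [s snet] := tbG _ e20; exists s => y /closure_mdistP/(_ _ e20)[z Gz yz].
have [x xs xz] := snet z Gz; exists x => //.
rewrite (le_lt_trans (metric_triangle _ z _))// [ltRHS]splitr ltrD//.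
by rewrite metric_sym.
Qed.

End MetricSpace.

(** * Covering numbers and upper bounds on the fractal dimension *)

Section FractalDimension.
Context {R : realType} {V : metricType R}.
Implicit Types (G H K : set V) (x y : V) (e r q h : R).

Lemma covering_number_antitone G e e' : e <= e' ->
  (covering_number G e' <= covering_number G e)%E.
Proof.
move=> ee'; apply: ereal_inf_le_tmp; apply: image_subset => n [c [Gc Gcov]].
exists c; split => // y /Gcov[i _ cy]; exists i => //.
exact: le_ball cy.
Qed.

Lemma fractal_dim_le G r :
  (forall d, 0 < d -> exists2 e0, 0 < e0 & forall e, 0 < e < e0 ->
    (elog e^-1 (covering_number G e) <= (r + d)%:E)%E) ->
  (fractal_dim G <= r%:E)%E.
Proof.
move=> Gr; apply/lee_addgt0Pr => d d0.
have [e0 e00 Ge] := Gr d d0.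
apply: ge_ereal_inf.
exists (ereal_sup [set elog e^-1 (covering_number G e) |
  e in [set e | 0 < e < e0]]).
  exists [set e | 0 < e < e0] => //=.
  near=> e; apply/andP; split; near: e.
    exact: nbhs_right_gt.
  exact: nbhs_right_lt.
by apply: ge_ereal_sup => _ [e /Ge ? <-].
Unshelve. all: by end_near. Qed.

Lemma fractal_dim_ltey G : (fractal_dim G < +oo)%E ->
  exists d e0, [/\ 0 < d, 0 < e0 & forall e, 0 < e < e0 ->
    (elog e^-1 (covering_number G e) <= d%:E)%E].
Proof.
move=> /ereal_inf_lt[_ [U U0 <-]] Ufin.
(* The supremum may be negative or [-oo]; a positive bound is taken so that the growth factor [h]
   later built from [d] is at least 1. *)
have [d d0 Ud] : exists2 d : R, 0 < d &
    (ereal_sup [set elog e^-1 (covering_number G e) | e in U] <= d%:E)%E.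
  move: Ufin; case: ereal_sup => [d _|//|_]; last by exists 1; rewrite ?leNye.
  by exists (Num.max d 1); rewrite ?lt_max ?ltr01 ?orbT// lee_fin le_max lexx.
have [e0 /= e00 Ue] := U0.
exists d, e0; split => // e /andP[epos ee0].
apply: le_trans Ud; apply: ereal_sup_ubound; exists e => //.
by apply: Ue => //=; rewrite /ball_ sub0r normrN gtr0_norm.
Qed.

Lemma elog_le (base r : R) (z : \bar R) : 1 < base -> 0 < r -> (z <= r%:E)%E ->
  (elog base z <= (ln r / ln base)%:E)%E.
Proof.
move=> b1 r0 zr; rewrite /elog EFinM lee_wpmul2r//.
  by rewrite lee_fin invr_ge0 ltW// ln_gt0.
move: zr; case: z => [z| |] /=; [|by rewrite leye_eq|by rewrite !leNye].
rewrite !lee_fin => zr; case: ifPn => [_|]; first by rewrite leNye.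
by rewrite -ltNge => z0; rewrite lee_fin ler_ln.
Qed.

Lemma le_elog (base d : R) (z : \bar R) : 1 < base -> (elog base z <= d%:E)%E ->
  (z <= (expR (d * ln base))%:E)%E.
Proof.
move=> b1; rewrite /elog; have lb : 0 < ln base by rewrite ln_gt0.
case: z => [z| |] /=; last by rewrite leNye.
  case: ifPn => [z0 _|]; first by rewrite lee_fin (le_trans z0)// expR_ge0.
  rewrite -ltNge => z0; rewrite -EFinM !lee_fin ler_pdivrMr// => zd.
  by rewrite -[z in z <= _]lnK// ler_expR.
by rewrite gt0_mulye ?leye_eq// lte_fin invr_gt0.
Qed.

(** Given a small [e], the first [m] with [a q^m < e] exceeds [x = (ln a + ln (1/e)) / ln (1/q)] by
    at most 1. Then [ln (C h^m)] is at most a constant plus [(ln h / ln (1/q)) ln (1/e)], and the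
    constant vanishes after division by [ln (1/e)]. *)
Lemma fractal_dim_geometric G (a C q h : R) (m0 : nat) :
  0 < a -> 0 < C -> 0 < q < 1 -> 1 <= h ->
  (forall m, (m0 <= m)%N ->
    (covering_number G (a * q ^+ m) <= (C * h ^+ m)%:E)%E) ->
  (fractal_dim G <= (ln h / ln q^-1)%:E)%E.
Proof.
move=> a0 C0 /andP[q0 q1] h1 Gm; apply: fractal_dim_le => d d0.
have h0 : 0 < h by exact: lt_le_trans h1.
set l := ln q^-1; have l0 : 0 < l by rewrite ln_gt0// invf_gt1.
have qE : q = expR (- l) by rewrite /l lnV ?opprK ?lnK// posrE.
(* [D] collects the terms independent of [e]. The four entries of [M] ensure in turn that [e < 1],
   [m0 <= m], [0 <= x] and [D < d L]. *)
set D := ln C + ln h * ln a / l + ln h.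
set M := Num.max 1 (Num.max (m0%:R * l - ln a) (Num.max (- ln a) (D / d))).
exists (expR (- M)); first exact: expR_gt0.
move=> e /andP[e0 eM]; set L := ln e^-1.
have eE : e = expR (- L) by rewrite /L lnV ?opprK ?lnK// posrE.
have : M < L by move: eM; rewrite eE ltr_expR ltrN2.
rewrite !gt_max => /and4P[L1 Lm0 La LD].
have L0 : 0 < L by exact: lt_trans L1.
set x := (ln a + L) / l.
have x0 : 0 <= x by rewrite divr_ge0 ?ltW//; lra.
set m := (Num.truncn x).+1.
have xm : x < m%:R by rewrite -truncn_lt_nat.
have mx : m%:R <= x + 1 by rewrite /m -natr1 lerD2r truncn_le.
have m0m : (m0 <= m)%N.
  by rewrite -(ler_nat R) ltW// (lt_trans _ xm)// /x ltr_pdivlMr//; lra.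
have aqe : a * q ^+ m <= e.
  rewrite qE eE -expRM_natl -[a in a * _]lnK// -expRD ler_expR.
  by move: xm; rewrite /x ltr_pdivrMr//; lra.
have Ne : (covering_number G e <= (C * h ^+ m)%:E)%E.
  exact: le_trans (covering_number_antitone _ aqe) (Gm _ m0m).
have e1 : 1 < e^-1 by rewrite invf_gt1// eE expR_lt1; lra.
have Chm : 0 < C * h ^+ m by rewrite mulr_gt0// exprn_gt0.
apply: le_trans (elog_le e1 Chm Ne) _.
rewrite lee_fin -/L lnM ?posrE ?exprn_gt0// lnXn// ler_pdivrMr//.
have lnh : 0 <= ln h by rewrite ln_ge0.
apply: (@le_trans _ _ (ln C + (x + 1) * ln h)).
  by rewrite lerD2l -mulr_natl ler_wpM2r.
have -> : ln C + (x + 1) * ln h = D + ln h / l * L.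
  by rewrite /x /D; field; rewrite gt_eqF.
by move: LD; rewrite ltr_pdivrMr// mulrDl addrC lerD2l [d * L]mulrC => /ltW.
Qed.

End FractalDimension.

(** * Limits along a continuous or discrete time set *)

Section TimeLimits.
Context {R : realType}.
Implicit Types (I : set R) (t e : R).

Lemma time_cvg0 I (f : R -> \bar R) : (forall t, 0 <= f t)%E ->
  (forall e, 0 < e -> exists t0, forall t, I t -> t0 <= t -> (f t <= e%:E)%E) ->
  f t @[t --> within I +oo] --> 0%E.
Proof.
move=> f0 fe A /= [e /= e0 eA].
have e20 : 0 < e / 2 by rewrite divr_gt0.
have [t0 ft] := fe _ e20.
exists t0; split; first exact: num_real.
move=> t t0t It /=; have := ft t It (ltW t0t); have := f0 t.
case: (f t) => [r| |] //; rewrite !lee_fin => r0 re.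
apply: (eA r); rewrite /= sub0r normrN ger0_norm//.
by rewrite (le_lt_trans re)// ltr_pdivrMr// ltr_pMr// ltr1n.
Qed.

Lemma time_cvg0_lt I (f : R -> \bar R) e : 0 < e ->
  f t @[t --> within I +oo] --> 0%E ->
  exists t0, forall t, I t -> t0 <= t -> (f t < e%:E)%E.
Proof.
move=> e0 /(_ [set z | (z < e%:E)%E])[|M [_ Mf]].
  exists e => //= r; rewrite /= sub0r normrN => re.
  by rewrite lte_fin (le_lt_trans (ler_norm _)).
exists (M + 1) => t It Mt; apply: Mf => //.
by rewrite (lt_le_trans _ Mt)// ltrDl.
Qed.

End TimeLimits.

(** * Omega-limit sets and the global attractor *)

Section Dynamics.
Context {R : realType} {V : metricType R}.
Variables (I : set R) (S : R -> V -> V).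
Hypotheses (hI : is_time_set I) (hS : is_semigroup I S).
Implicit Types (G H K M B : set V) (x y p : V) (s t e T : R).

Lemma time0 : I 0.
Proof. by case: hI => -> //=; exists 0%N. Qed.

Lemma time_ge0 t : I t -> 0 <= t.
Proof. by case: hI => -> // [n _ <-]; exact: ler0n. Qed.

Lemma timeD s t : I s -> I t -> I (s + t).
Proof.
case: hI => -> /=; first exact: addr_ge0.
by move=> [m _ <-] [n _ <-]; exists (m + n)%N; rewrite ?natrD.
Qed.

Lemma timeB s t : I s -> I t -> s <= t -> I (t - s).
Proof.
case: hI => -> /=; first by rewrite subr_ge0.
move=> [m _ <-] [n _ <-]; rewrite ler_nat => mn.
by exists (n - m)%N; rewrite ?natrB.
Qed.

Lemma time_nat (n : nat) : I n%:R.
Proof. by case: hI => -> /=; [exact: ler0n|exists n]. Qed.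

Lemma timeMn T (n : nat) : I T -> I (n%:R * T).
Proof.
move=> IT; elim: n => [|n IHn]; first by rewrite mul0r; exact: time0.
by rewrite -natr1 mulrDl mul1r; exact: timeD.
Qed.

Lemma time_unbounded t : exists2 s, I s & t <= s.
Proof.
exists (Num.truncn `|t|).+1%:R; first exact: time_nat.
by rewrite (le_trans (ler_norm t))// ltW// -truncn_lt_nat.
Qed.

Lemma semigroupD s t x : I s -> I t -> S (s + t) x = S s (S t x).
Proof. by move=> Is It; rewrite hS.2. Qed.

Definition attracts K := forall G e, bounded_metric G -> 0 < e ->
  exists t0, forall t x, I t -> t0 <= t -> G x ->
    exists2 y, K y & mdist (S t x) y < e.

Lemma attracts_hdist K G : attracts K -> bounded_metric G ->
  hdist (S t @` G) K @[t --> within I +oo] --> 0%E.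
Proof.
move=> attK bG; apply: time_cvg0 => [t|e e0]; first exact: hdist_ge0.
have [t0 Gt] := attK G e bG e0; exists t0 => t It t0t.
apply: hdist_le (ltW e0) _ => _ [x Gx <-].
by have [y Ky xy] := Gt t x It t0t Gx; exists y => //; exact: ltW.
Qed.

(** The bound [s] may be any real number since the time set is unbounded. *)
Lemma omega_limitP G x : omega_limit I S G x <->
  forall s e, 0 < e -> exists t y, [/\ I t, s <= t, G y & mdist x (S t y) < e].
Proof.
split=> [Gx s e e0|Gx s Is].
  have [s' Is' ss'] := time_unbounded s.
  have /closure_mdistP/(_ e e0)[_ [t [It s't] [y Gy <-]] xy] := Gx s' Is'.
  by exists t, y; split => //; exact: le_trans ss' s't.
apply/closure_mdistP => e e0.
have [t [y [It st Gy xy]]] := Gx s e e0.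
by exists (S t y) => //; exists t => //; exists y.
Qed.

Lemma closed_omega_limit G : closed (omega_limit I S G).
Proof. by apply: closed_bigI => s _; exact: closed_closure. Qed.

Lemma invariant_sub_omega_limit G H : (forall t, I t -> G `<=` S t @` H) ->
  G `<=` omega_limit I S H.
Proof.
move=> GH x Gx; apply/omega_limitP => s e e0.
have [t It st] := time_unbounded s.
have [y Hy yx] := GH t It x Gx.
by exists t, y; split => //; rewrite yx mdistxx.
Qed.

Lemma bounded_metric_sub G H : G `<=` H -> bounded_metric H -> bounded_metric G.
Proof. by move=> GH [M HM]; exists M => x y /GH Hx /GH Hy; exact: HM. Qed.

Section CompactAttracting.
Variable K : set V.
Hypotheses (hSac : asymptotically_closed I S) (cK : compact K).
Hypothesis attK : attracts K.

Lemma omega_limit_sub G : bounded_metric G -> omega_limit I S G `<=` K.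
Proof.
have clK : closed K by apply: compact_closed => //; exact: metric_hausdorff.
move=> bG x /omega_limitP Gx; apply: clK; apply/closure_mdistP => e e0.
have e20 : 0 < e / 2 by rewrite divr_gt0.
have [t0 Gt] := attK bG e20.
have [t [y [It t0t Gy xy]]] := Gx t0 _ e20.
have [z Kz yz] := Gt t y It t0t Gy.
exists z => //.
by rewrite (le_lt_trans (metric_triangle _ (S t y) _))// [ltRHS]splitr ltrD.
Qed.

(** Asymptotic compactness: the points [S (tk k) (xk k)] come ever closer to points of [K], and a
    cluster point of the latter is a limit of the former. The map [phi] need not be increasing;
    [k <= phi k] suffices to send the times to infinity. *)
Lemma asymptotic_subseq G (tk : nat -> R) (xk : nat -> V) : bounded_metric G ->
  (forall k, I (tk k)) -> (forall k, k%:R <= tk k) -> (forall k, G (xk k)) ->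
  exists p (phi : nat -> nat), forall k,
    (k <= phi k)%N /\ mdist p (S (tk (phi k)) (xk (phi k))) < k.+1%:R^-1.
Proof.
move=> bG Itk ktk Gxk.
have near_K (n : nat) : exists z : nat * V, [/\ (n <= z.1)%N, K z.2 &
    mdist (S (tk z.1) (xk z.1)) z.2 < n.+1%:R^-1].
  have [|t0 Gt] := attK bG (e := n.+1%:R^-1); first by rewrite invr_gt0.
  set k := maxn n (Num.truncn `|t0|).+1.
  have t0k : t0 <= tk k.
    rewrite (le_trans _ (ktk k))// (le_trans (ler_norm _))//.
    rewrite (@le_trans _ _ (Num.truncn `|t0|).+1%:R)//.
      by rewrite ltW// -truncn_lt_nat.
    by rewrite ler_nat leq_maxr.
  have [y Ky xy] := Gt _ _ (Itk k) t0k (Gxk k).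
  by exists (k, y); split => //=; exact: leq_maxl.
have [z zP] := choice near_K.
have Kz n : K (z n).2 by have [] := zP n.
have [p _ pz] := compact_subseq cK Kz.
have /choice[phi phiP] (k : nat) : exists m,
    (k <= m)%N /\ mdist p (S (tk m) (xk m)) < k.+1%:R^-1.
  have k0 : 0 < (k.+1%:R^-1 / 2 : R) by rewrite divr_gt0// invr_gt0.
  (* With [n] at least [2 (k + 1)], the distance to [K] also uses up at most half of
     [1 / (k + 1)]. *)
  have [n kn pn] := pz _ (k.+1.*2)%N k0.
  have [nz _ xz] := zP n.
  exists (z n).1; split.
    rewrite (leq_trans _ nz)// (leq_trans _ kn)// -addnn.
    exact: leq_trans (leqnSn k) (leq_addr _ _).
  rewrite (le_lt_trans (metric_triangle _ (z n).2 _))// [ltRHS]splitr.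
  rewrite ltrD// metric_sym (lt_le_trans xz)// -invfM lef_pV2 ?posrE//.
  by rewrite -natrM ler_nat muln2 (leq_trans kn)//.
by exists p, phi.
Qed.

Lemma time_cvgy (tk : nat -> R) : (forall k, k%:R <= tk k) -> tk @ \oo --> +oo.
Proof.
move=> ktk; apply/cvgryPge => M; exists (Num.truncn `|M|).+1 => // k /= Mk.
rewrite (le_trans _ (ktk k))// (le_trans (ler_norm _))//.
rewrite (@le_trans _ _ (Num.truncn `|M|).+1%:R) ?ler_nat//.
by rewrite ltW// -truncn_lt_nat.
Qed.

Lemma inv_nat_cvg (u : nat -> V) x : (forall k, mdist x (u k) < k.+1%:R^-1) ->
  u @ \oo --> x.
Proof.
move=> ux; apply/metricType_numDomainType.cvgrPdist_lt => e e0.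
have := near_infty_natSinv_lt (PosNum e0).
by apply: filterS => k /=; exact: lt_trans.
Qed.

Lemma omega_limit_seq G x : omega_limit I S G x <->
  exists (tk : nat -> R) (xk : nat -> V), [/\ forall k, I (tk k),
    forall k, k%:R <= tk k, forall k, G (xk k) &
    forall k, mdist x (S (tk k) (xk k)) < k.+1%:R^-1].
Proof.
split=> [/omega_limitP Gx|[tk [xk [Itk ktk Gxk xtk]]]].
  have /choice[z zP] (k : nat) : exists z : R * V, [/\ I z.1, k%:R <= z.1,
      G z.2 & mdist x (S z.1 z.2) < k.+1%:R^-1].
    have [|t [y [? ? ? ?]]] := Gx k%:R k.+1%:R^-1; first by rewrite invr_gt0.
    by exists (t, y).
  by exists (fst \o z), (snd \o z); split => k; have [] := zP k.
apply/omega_limitP => s e e0.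
have tky := time_cvgy ktk; move/cvgryPge: tky => /(_ s) sk.
have ek := near_infty_natSinv_lt (PosNum e0).
have [k [/= sk1 ek1]] := filter_ex (filterI sk ek).
by exists (tk k), (xk k); split => //; exact: lt_trans (xtk k) ek1.
Qed.

Lemma omega_limit_nonempty G : bounded_metric G -> G !=set0 ->
  omega_limit I S G !=set0.
Proof.
move=> bG [x Gx].
have [p [phi phiP]] :=
  asymptotic_subseq bG time_nat (fun k => lexx k%:R) (fun=> Gx).
exists p; apply/omega_limit_seq; exists (fun k => (phi k)%:R), (fun=> x).
split=> // k; first exact: time_nat; last exact: (phiP k).2.
by rewrite ler_nat; exact: (phiP k).1.
Qed.

Lemma bounded_range G (xk : nat -> V) : bounded_metric G ->
  (forall k, G (xk k)) -> bounded_metric (range xk).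
Proof. by move=> bG Gxk; apply: bounded_metric_sub bG => _ [k _ <-]. Qed.

(* Both inclusions use asymptotic compactness to extract a limit [y] of
   [S(t + t_k) x_k], resp. of [S(t_k - t) x_k]; asymptotic closedness then
   links [x] and [y]. *)
Lemma omega_limit_invariant G t : bounded_metric G -> I t ->
  S t @` omega_limit I S G = omega_limit I S G.
Proof.
move=> bG It; apply/seteqP; split.
  move=> _ [x /omega_limit_seq[tk [xk [Itk ktk Gxk xtk]]] <-].
  have Itk' k : I (t + tk k) by exact: timeD.
  have ktk' k : k%:R <= t + tk k.
    by rewrite (le_trans (ktk k))// lerDr; exact: time_ge0.
  have [y [phi phiP]] := asymptotic_subseq bG Itk' ktk' Gxk.
  have phik k : k%:R <= (phi k)%:R :> R by rewrite ler_nat; exact: (phiP k).1.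
  have -> : S t x = y.
    apply: (hSac (tk := tk \o phi) (xk := xk \o phi)) => //=.
    - by apply: time_cvgy => k; rewrite (le_trans (phik k))//; exact: ktk.
    - by apply: (bounded_range (G := G)) => // k; exact: Gxk.
    - apply: inv_nat_cvg => k; rewrite (lt_le_trans (xtk _))//.
      by rewrite lef_pV2 ?posrE// ler_nat ltnS; exact: (phiP k).1.
    - by apply: inv_nat_cvg => k; exact: (phiP k).2.
  apply/omega_limit_seq; exists (fun k => t + tk (phi k)), (xk \o phi).
  split=> k /=; [exact: Itk'| |exact: Gxk|exact: (phiP k).2].
  by rewrite (le_trans (phik k)).
move=> x /omega_limitP Gx.
have /choice[z zP] (k : nat) : exists z : R * V, [/\ I z.1, t + k%:R <= z.1,
    G z.2 & mdist x (S z.1 z.2) < k.+1%:R^-1].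
  have [|s [y [? ? ? ?]]] := Gx (t + k%:R) k.+1%:R^-1;
    first by rewrite invr_gt0.
  by exists (s, y).
set tk := fun k => (z k).1 - t; set xk := fun k => (z k).2.
have Gxk k : G (xk k) by have [] := zP k.
have Itk k : I (tk k).
  have [Iz tz _ _] := zP k; apply: timeB => //.
  by rewrite (le_trans _ tz)// lerDl.
have ktk k : k%:R <= tk k by have [_ tz _ _] := zP k; rewrite lerBrDl.
have [y [phi phiP]] := asymptotic_subseq bG Itk ktk Gxk.
have phik k : k%:R <= (phi k)%:R :> R by rewrite ler_nat; exact: (phiP k).1.
exists y.
  apply/omega_limit_seq; exists (tk \o phi), (xk \o phi).
  split=> k /=; [exact: Itk| |exact: Gxk|exact: (phiP k).2].
  by rewrite (le_trans (phik k)).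
apply: (hSac (tk := tk \o phi) (xk := xk \o phi)) => //=.
- by apply: time_cvgy => k; rewrite (le_trans (phik k))//; exact: ktk.
- by apply: (bounded_range (G := G)) => // k; exact: Gxk.
- by apply: inv_nat_cvg => k; exact: (phiP k).2.
- apply: inv_nat_cvg => k; rewrite /tk /xk subrKC.
  have [_ _ _ xz] := zP (phi k); rewrite (lt_le_trans xz)//.
  by rewrite lef_pV2 ?posrE// ler_nat ltnS; exact: (phiP k).1.
Qed.

(** Otherwise there are orbit points at times tending to infinity that stay [e] away from the
    omega-limit set; but a limit of a subsequence of them belongs to it. *)
Lemma omega_limit_attracts G e : bounded_metric G -> 0 < e ->
  exists t0, forall t x, I t -> t0 <= t -> G x ->
    exists2 y, omega_limit I S G y & mdist (S t x) y < e.
Proof.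
move=> bG e0; apply: contrapT => /forallNP noe.
have /choice[z zP] (k : nat) : exists z : R * V, [/\ I z.1, k%:R <= z.1, G z.2 &
    forall y, omega_limit I S G y -> e <= mdist (S z.1 z.2) y].
  have /existsNP[t /existsNP[x /not_implyP[It /not_implyP[kt]]]] := noe k%:R.
  move=> /not_implyP[Gx noy]; exists (t, x); split => //= y Gy.
  by rewrite leNgt; apply/negP => ye; apply: noy; exists y.
have Itk k : I (z k).1 by have [] := zP k.
have ktk k : k%:R <= (z k).1 by have [] := zP k.
have Gxk k : G (z k).2 by have [] := zP k.
have [p [phi phiP]] := asymptotic_subseq bG Itk ktk Gxk.
have Gp : omega_limit I S G p.
  apply/omega_limit_seq; exists (fst \o z \o phi), (snd \o z \o phi).
  split=> k /=; [exact: Itk| |exact: Gxk|exact: (phiP k).2].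
  by rewrite (le_trans _ (ktk _))// ler_nat; exact: (phiP k).1.
have [k /= ke] := filter_ex (near_infty_natSinv_lt (PosNum e0)).
have [_ _ _ /(_ _ Gp)] := zP (phi k).
by rewrite metric_sym leNgt (lt_trans (phiP k).2 ke).
Qed.

(** The omega-limit set of [G] is invariant and lies in [K], so each of its points is reached from
    [K] at arbitrarily late times. Hence one set, that of [K], attracts all bounded sets. *)
Lemma omega_limit_maximal G : bounded_metric G ->
  omega_limit I S G `<=` omega_limit I S K.
Proof.
move=> bG; apply: invariant_sub_omega_limit => t It x.
rewrite -{1}(omega_limit_invariant bG It) => -[y Gy <-].
by exists y => //; exact: omega_limit_sub Gy.
Qed.

Lemma global_attractor_omega_limit : K !=set0 ->
  global_attractor I S (omega_limit I S K).
Proof.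
move=> K0; have bK := compact_bounded_metric cK; split.
- exact: omega_limit_nonempty.
- apply: subclosed_compact cK _; first exact: closed_omega_limit.
  exact: omega_limit_sub.
- by move=> t It; exact: omega_limit_invariant.
- move=> G; apply: attracts_hdist => {}G e bG e0.
  have [t0 Gt] := omega_limit_attracts bG e0; exists t0 => t x It t0t Gx.
  have [y Gy xy] := Gt t x It t0t Gx.
  by exists y => //; exact: omega_limit_maximal Gy.
Qed.

End CompactAttracting.
End Dynamics.

(** * From a discrete exponential attractor to the covering condition *)

Section CoveringOfAttractor.
Context {R : realType} {V : metricType R}.
Variables (I : set R) (S : R -> V -> V) (T : R).
Hypotheses (hI : is_time_set I) (hTI : I T) (hT : 0 < T).
Implicit Types (G H M B : set V) (s : seq V) (e : R).

(** Covering numbers ask for centers in the covered set: each center is moved to a point of [G] in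
    its ball, which at most doubles the radius. *)
Lemma recenter_net s e G : eps_net s e G ->
  exists s', [/\ (size s' <= size s)%N, {in s', forall x, G x} &
    eps_net s' (2 * e) G].
Proof.
move=> snet; have [->|/set0P[g Gg]] := eqVneq G set0;
  first by exists [::]; split => // y.
(* A center whose ball misses [G] is sent to the default point [g]. *)
have /choice[f fP] (c : V) : exists x, G x /\
    ((exists2 y, G y & mdist c y < e) -> mdist c x < e).
  by have [[y Gy cy]|no] := pselect (exists2 y, G y & mdist c y < e);
    [exists y | exists g].
exists (map f s); split; first by rewrite size_map.
  by move=> _ /mapP[c _ ->]; exact: (fP c).1.
move=> y Gy; have [c cs cy] := snet y Gy; exists (f c); first exact: map_f.
have fc : mdist c (f c) < e by apply: (fP c).2; exists y.
rewrite (le_lt_trans (metric_triangle _ c _))// [2 * e]mulr_natl mulr2n ltrD//.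
by rewrite metric_sym.
Qed.

Lemma hdist_expR_lt (s : R) (z : \bar R) :
  ((expR s)%:E * z < 1)%E -> (z < (expR (- s))%:E)%E.
Proof.
case: z => [z| |] //=; last by rewrite ltNye_eq.
  by rewrite -EFinM !lte_fin expRN -[_^-1]mul1r ltr_pdivlMr ?expR_gt0// mulrC.
by rewrite gt0_muley ?lte_fin ?expR_gt0.
Qed.

Lemma covering_of_attractor M0 : discrete_exp_attractor I S T M0 ->
  exists B : set V,
    [/\ B !=set0, bounded_metric B, absorbing I S B &
        exists (k0 : nat) (a b q h : R),
          [/\ (0 < k0)%N, 0 < a /\ 0 < b, 0 < q < 1, 1 <= h &
              covering_condition S T B k0 a b q h]].
Proof.
move=> [[x0 Mx0] cM _ /fractal_dim_ltey[d [e0 [d0 e00 dimM]]] [xi xi0 attM]].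
pose B := [set x | exists2 y, M0 y & mdist x y < 1].
have bB : bounded_metric B.
  have [c Mc] := compact_bounded_metric cM.
  exists (1 + c + 1) => x y [x' Mx xx'] [y' My yy'].
  rewrite (le_trans (metric_triangle _ y' _))// lerD//; last first.
    by rewrite metric_sym ltW.
  by rewrite (le_trans (metric_triangle _ x' _))// lerD ?(ltW xx')// Mc.
have attG G : bounded_metric G -> exists2 tG, I tG & forall t, I t -> tG <= t ->
    forall x, G x -> exists2 y, M0 y & mdist (S t x) y < expR (- (xi * t)).
  move=> bG; have [t0 Gt0] := time_cvg0_lt ltr01 (attM G bG).
  have [tG ItG t0tG] := time_unbounded hI t0.
  exists tG => // t It tGt x Gx.
  apply: (hdist_lt (G := S t @` G)); last by exists x.
  by apply: hdist_expR_lt; apply: Gt0 => //; exact: le_trans tGt.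
exists B; split => //.
- by exists x0, x0 => //; rewrite mdistxx.
- move=> G bG; have [tG ItG Gt] := attG G bG.
  exists tG => // t It tGt _ [x Gx <-].
  have [y My xy] := Gt t It tGt x Gx; exists y => //.
  rewrite (lt_le_trans xy)// -expR0 ler_expR oppr_le0 mulr_ge0 ?(ltW xi0)//.
  exact: time_ge0 It.
have [tB ItB Bt] := attG B bB.
pose q := expR (- (xi * T)).
have xiT0 : 0 < xi * T by rewrite mulr_gt0.
have qkE (k : nat) : q ^+ k = expR (- (xi * (k%:R * T))).
  by rewrite /q -expRM_natl; congr expR; ring.
(* From [k0] on, [kT] is past the attraction time [tB] and [q^k] is below [e0]; the successor makes
   [k] positive, hence [q^k < 1]. *)
pose k0 := (Num.truncn (`|tB / T| + `|ln e0 / (xi * T)|)).+1.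
have kP (k : nat) : (k0 <= k)%N -> tB <= k%:R * T /\ q ^+ k < e0.
  move=> k0k; have : `|tB / T| + `|ln e0 / (xi * T)| < k%:R.
    rewrite (@lt_le_trans _ _ k0%:R) ?ler_nat//.
    by rewrite -truncn_lt_nat// addr_ge0.
  move=> ltk; split.
    rewrite -ler_pdivrMr// (le_trans (ler_norm _))//.
    by rewrite (le_trans _ (ltW ltk))// lerDl.
  rewrite qkE -[ltRHS]lnK ?posrE// ltr_expR ltrNl.
  rewrite (_ : xi * _ = k%:R * (xi * T)); last by ring.
  rewrite -ltr_pdivrMr// mulNr (le_lt_trans (ler_norm _))// normrN.
  by rewrite (le_lt_trans _ ltk)// lerDr.
(* The cover of [M0] and the distance from [S(kT) B] to [M0] contribute [q^k] each, and recentering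
   doubles the sum, whence 4. The growth factor is [q^(-d)], as [M0] has at most [(q^k)^(-d)] balls
   of radius [q^k]. *)
exists k0, 4, 1, q, (expR (d * (xi * T))); split => //.
- by rewrite expR_gt0 expR_lt1 oppr_lt0.
- by rewrite -expR0 ler_expR mulr_ge0 ?ltW.
move=> k k0k; have [tBk qke] := kP k k0k.
have qk0 : 0 < q ^+ k by rewrite exprn_gt0 ?expR_gt0.
have qk1 : q ^+ k < 1.
  rewrite exprn_ilt1 ?expR_ge0//; last by rewrite expR_lt1 oppr_lt0.
  by rewrite -lt0n (leq_trans _ k0k).
have IkT := timeMn hI k hTI.
have := dimM (q ^+ k); rewrite qk0 qke => /(_ isT).
move=> /le_elog; rewrite invf_gt1// => /(_ qk1).
move=> /covering_number_le_net[s [sh _ snet]].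
have snet2 : eps_net s (2 * q ^+ k) (S (k%:R * T) @` B).
  move=> _ [x Bx <-].
  have [y My xy] := Bt _ IkT tBk x Bx.
  have [c cs cy] := snet y My; exists c => //.
  rewrite (le_lt_trans (metric_triangle _ y _))// [2 * _]mulr_natl mulr2n ltrD//.
  by rewrite metric_sym qkE.
have [s' [s's s'B s'net]] := recenter_net snet2.
rewrite (_ : 4 * _ = 2 * (2 * q ^+ k)); last by ring.
apply: (le_trans (covering_number_net_le s'B s'net)).
rewrite lee_fin mul1r (@le_trans _ _ (size s)%:R) ?ler_nat// (le_trans sh)//.
rewrite -expRM_natl qkE -expRN opprK expRK.
by rewrite (_ : d * (xi * (_ * T)) = k%:R * (d * (xi * T)))//; ring.
Qed.

End CoveringOfAttractor.

(** * From the covering condition to the discrete exponential attractor *)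

Section AttractorOfCovering.
Context {R : realType} {V : metricType R}.
Variables (I : set R) (S : R -> V -> V) (T : R).
Hypotheses (hV : complete_metric V) (hI : is_time_set I).
Hypotheses (hS : is_semigroup I S) (hSac : asymptotically_closed I S).
Hypotheses (hTI : I T) (hT : 0 < T).
Variables (B : set V) (a b q h : R) (k1 : nat) (W : nat -> seq V).
Hypotheses (B0 : B !=set0) (bB : bounded_metric B) (absB : absorbing I S B).
Hypotheses (a0 : 0 < a) (b0 : 0 < b) (q01 : 0 < q < 1) (h1 : 1 <= h).
Hypothesis SB : forall t, I t -> k1%:R * T <= t -> S t @` B `<=` B.
Hypothesis Wsize : forall k, (k1 <= k)%N -> (size (W k))%:R <= b * h ^+ k.
Hypothesis WB : forall k x, (k1 <= k)%N -> x \in W k -> (S (k%:R * T) @` B) x.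
Hypothesis Wnet : forall k, (k1 <= k)%N ->
  eps_net (W k) (a * q ^+ k) (S (k%:R * T) @` B).
Implicit Types (G H M : set V) (s : seq V) (x y : V) (e t g : R) (n m k : nat).

Local Notation SB_ k := (S (k%:R * T) @` B).

Fixpoint centers n : seq V :=
  if n is n'.+1 then W (k1 + n) ++ map (S T) (centers n') else W k1.

Definition E0 : set V := [set x | exists n, x \in centers n].

Definition early_centers m : seq V := flatten [seq centers n | n <- iota 0 m].

(** Split [S(kT)] as [S(mT) S((k - m)T)]; since [k - m >= k1], the inner map sends [B] into
    itself. *)
Lemma iterate_image_sub k m : (k1 + m <= k)%N -> SB_ k `<=` SB_ m.
Proof.
move=> mk _ [x Bx <-].
have [mk' Ik Im] : [/\ (m <= k)%N, I ((k - m)%:R * T) & I (m%:R * T)].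
  by split; [exact: leq_trans (leq_addl _ _) mk|exact: timeMn|exact: timeMn].
exists (S ((k - m)%:R * T) x).
  by apply: (SB Ik); [rewrite ler_pM2r// ler_nat leq_subRL// addnC|exists x].
by rewrite -(semigroupD hS)// -mulrDl -natrD subnKC.
Qed.

Lemma centers_image n x : x \in centers n -> SB_ (k1 + n) x.
Proof.
elim: n x => [|n IHn] x /=; first by rewrite addn0; exact: WB.
rewrite mem_cat => /orP[|/mapP[y /IHn[z Bz <-] ->]].
  by apply: WB; exact: leq_addr.
exists z => //; rewrite -(semigroupD hS)//; last exact: timeMn.
by rewrite addnS -natr1 mulrDl mul1r addrC.
Qed.

Lemma E0_subset : E0 `<=` B.
Proof.
move=> x [n /centers_image]; apply: SB; first exact: timeMn.
by rewrite ler_pM2r// ler_nat leq_addr.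
Qed.

Lemma W_sub_E0 m x : (k1 <= m)%N -> x \in W m -> E0 x.
Proof.
move=> k1m xW; exists (m - k1)%N.
case: (m - k1)%N (subnKC k1m) => [|n] /= nm; first by rewrite -[k1]addn0 nm.
by rewrite nm mem_cat xW.
Qed.

Lemma E0_positively_invariant : S T @` E0 `<=` E0.
Proof.
by move=> _ [x [n xn] <-]; exists n.+1; rewrite /= mem_cat map_f ?orbT.
Qed.

Lemma countable_E0 : countable E0.
Proof.
have -> : E0 = \bigcup_(n in [set: nat]) [set` centers n].
  by apply/seteqP; split => x [n]; [exists n|move=> _; exists n].
apply: bigcup_countable => // n _; apply: finite_set_countable.
exact: finite_seq.
Qed.

Lemma mem_early_centers m x :
  x \in early_centers m <-> exists2 n, (n < m)%N & x \in centers n.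
Proof.
split=> [/flattenP[s /mapP[n nm ->] xn]|[n nm xn]].
  by exists n => //; rewrite mem_iota in nm.
by apply/flattenP; exists (centers n) => //; apply: map_f; rewrite mem_iota.
Qed.

Lemma E0_split m : E0 `<=` [set` early_centers m] `|`
  [set x | exists2 n, (m <= n)%N & x \in centers n].
Proof.
move=> x [n xn]; have [mn|nm] := leqP m n; first by right; exists n.
by left; apply/mem_early_centers; exists n.
Qed.

Lemma late_centers_image m n x : (m <= n)%N -> x \in centers n -> SB_ m x.
Proof.
by move=> mn /centers_image; apply: iterate_image_sub; rewrite leq_add2l.
Qed.

(** Late centers lie in [S(mT) B] and are covered by [W m]; the finitely many early ones are their
    own centers. This is applied to [E0] for total boundedness and to its closure for the
    dimension. *)
Lemma W_early_net m H : (k1 <= m)%N -> H `<=` SB_ m `|` E0 ->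
  eps_net (W m ++ early_centers m) (a * q ^+ m) H.
Proof.
move=> k1m HB y Hy; have /andP[q0 _] := q01.
suff [ym|ym] : SB_ m y \/ y \in early_centers m.
- by have [x xW xy] := Wnet k1m ym; exists x; rewrite // mem_cat xW.
- exists y; first by rewrite mem_cat ym orbT.
  by rewrite mdistxx mulr_gt0// exprn_gt0.
case: (HB y Hy) => [|/(@E0_split m)[|[n mn yn]]]; [by left|by right|left].
exact: late_centers_image yn.
Qed.

Lemma W_early_E0 m x : (k1 <= m)%N -> x \in W m ++ early_centers m -> E0 x.
Proof.
move=> k1m; rewrite mem_cat => /orP[|/mem_early_centers[n _ xn]].
  exact: W_sub_E0.
by exists n.
Qed.

(** Both [centers] and [early_centers] have sizes bounded by geometric sums of ratio [g]. The strict
    inequality [1 < g] keeps these sums of order [g^m], which would fail for ratio 1. *)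
Lemma size_W_early g : h <= g -> 1 < g -> exists2 C, 0 < C &
  forall m, (k1 <= m)%N -> (size (W m ++ early_centers m))%:R <= C * g ^+ m.
Proof.
move=> hg g1; have g0 : 0 < g by exact: lt_trans g1.
have gB1 : 0 < g - 1 by rewrite subr_gt0.
have Wg k : (k1 <= k)%N -> (size (W k))%:R <= b * g ^+ k.
  move=> k1k; rewrite (le_trans (Wsize k1k))// ler_pM2l// lerXn2r ?nnegrE//.
    exact: le_trans h1.
  exact: ltW.
(* The constants are the solutions of [C1E] and [C2E], which are exactly the two induction steps. *)
pose C1 := b * g / (g - 1); pose C2 := C1 / (g - 1).
have C10 : 0 < C1 by rewrite divr_gt0// mulr_gt0.
have C20 : 0 < C2 by rewrite divr_gt0.
have C1E : b * g + C1 = C1 * g by rewrite /C1; field; rewrite gt_eqF.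
have C2E : C2 + C1 = C2 * g by rewrite /C2; field; rewrite gt_eqF.
have size_centers n : (size (centers n))%:R <= C1 * g ^+ (k1 + n).
  elim: n => [|n IHn] /=.
    rewrite addn0 (le_trans (Wg _ (leqnn _)))// ler_pM2r ?exprn_gt0//.
    by rewrite /C1 ler_pdivlMr// ler_pM2l// gerBl.
  rewrite size_cat size_map natrD addnS exprS mulrA -C1E mulrDl.
  by rewrite lerD// -mulrA -exprS -addnS Wg// leq_addr.
have size_early m : (size (early_centers m))%:R <= C2 * g ^+ (k1 + m).
  elim: m => [|m IHm]; first by rewrite mulr_ge0 ?exprn_ge0// ltW.
  rewrite /early_centers -addn1 iotaD map_cat flatten_cat size_cat /= cats0.
  by rewrite natrD addn1 addnS exprS mulrA -C2E mulrDl lerD.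
exists (b + C2 * g ^+ k1); first by rewrite addr_gt0// mulr_gt0// exprn_gt0.
move=> m k1m; rewrite size_cat natrD mulrDl lerD ?Wg//.
by rewrite -mulrA -exprD.
Qed.

Lemma E0_net e : 0 < e -> exists s, eps_net s e E0.
Proof.
move=> e0; have /andP[q0 q1] := q01.
have : (fun m => a * q ^+ m) @ \oo --> (0 : R).
  rewrite -[X in _ --> X](mulr0 a); apply: cvgMr; apply: cvg_expr.
  by rewrite gtr0_norm.
move=> /cvgr0Pnorm_lt/(_ e e0) qe.
have [m /= [k1m me]] := filter_ex (filterI (nbhs_infty_ge k1) qe).
exists (W m ++ early_centers m) => y E0y.
have [x xW xy] := W_early_net k1m (@subsetUr _ (SB_ m) E0) E0y.
by exists x => //; rewrite (lt_trans xy)// (le_lt_trans _ me)// ler_norm.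
Qed.

Lemma compact_closure_E0 : compact (closure E0).
Proof. exact: compact_closure_net hV E0_net. Qed.

Local Notation rate := (T^-1 * ln q^-1).

Lemma rate_gt0 : 0 < rate.
Proof.
by have /andP[q0 q1] := q01; rewrite mulr_gt0 ?invr_gt0// ln_gt0// invf_gt1.
Qed.

(** Let [k] be the largest integer with [kT <= t - tG]. Then [S(t - kT)] maps [G] into [B], so
    [S(t) x] lies in [S(kT) B], within [a q^k] of a point of [W k]. *)
Lemma E0_exp_near G : bounded_metric G -> exists t0 C, 0 < C /\
  forall t x, I t -> t0 <= t -> G x ->
    exists2 y, E0 y & mdist (S t x) y <= C * expR (- (rate * t)).
Proof.
move=> bG; have /andP[q0 q1] := q01; have [tG ItG Gt] := absB bG.
have l0 : 0 < ln q^-1 by rewrite ln_gt0// invf_gt1.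
(* The delay [k1 T] ensures [k1 <= k]. In the constant, the factor [1/q] pays for rounding [k] down
   and [expR (rate * tG)] for the absorption time. *)
exists (tG + k1%:R * T), (a * expR (ln q^-1 + rate * tG)); split.
  by rewrite mulr_gt0// expR_gt0.
move=> t x It t0t Gx.
pose k := Num.truncn ((t - tG) / T).
have tGt : 0 <= (t - tG) / T.
  rewrite divr_ge0 ?(ltW hT)// subr_ge0 (le_trans _ t0t)// lerDl.
  by rewrite mulr_ge0// ltW.
have kt : k%:R * T <= t - tG by rewrite -ler_pdivlMr// truncn_le.
have tk : (t - tG) / T < k%:R + 1 by rewrite natr1 -truncn_lt_nat.
have k1k : (k1 <= k)%N.
  by rewrite truncn_ge_nat// ler_pdivlMr// lerBrDl.
have IkT := timeMn hI k hTI.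
have Itk : I (t - k%:R * T).
  by apply: timeB => //; rewrite (le_trans kt)// gerBl (time_ge0 hI).
have BS : SB_ k (S t x).
  exists (S (t - k%:R * T) x); last by rewrite -(semigroupD hS)// addrC subrK.
  by apply: (Gt _ Itk); [rewrite lerBrDr addrC -lerBrDr|exists x].
have [y yW xy] := Wnet k1k BS; exists y; first exact: W_sub_E0 yW.
rewrite metric_sym (le_trans (ltW xy))// -[leRHS]mulrA ler_pM2l// -expRD.
have -> : q ^+ k = expR (- (k%:R * ln q^-1)).
  by rewrite lnV ?posrE// mulrN opprK expRM_natl lnK.
rewrite ler_expR lerNl.
have -> : - (ln q^-1 + rate * tG + - (rate * t)) = ((t - tG) / T - 1) * ln q^-1.
  by field; rewrite gt_eqF.
by rewrite ler_pM2r// lerBlDr ltW.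
Qed.

Lemma exp_decay (C r e t : R) : 0 < C -> 0 < r -> 0 < e -> ln (C / e) / r < t ->
  C * expR (- (r * t)) < e.
Proof.
move=> C0 r0 e0; rewrite ltr_pdivrMr// => rt.
rewrite expRN ltr_pdivrMr ?expR_gt0// -ltr_pdivrMl// [_^-1 * _]mulrC.
by rewrite -[ltLHS]lnK ?posrE ?divr_gt0// ltr_expR [r * t]mulrC.
Qed.

Lemma attracts_closure_E0 : attracts I S (closure E0).
Proof.
move=> G e bG e0; have [t0 [C [C0 Gt]]] := E0_exp_near bG.
exists (Num.max t0 (ln (C / e) / rate + 1)) => t x It.
rewrite ge_max => /andP[t0t rt] Gx; have [y E0y xy] := Gt t x It t0t Gx.
exists y; first exact: subset_closure.
rewrite (le_lt_trans xy)// exp_decay ?rate_gt0//.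
by rewrite (lt_le_trans _ rt)// ltrDl.
Qed.

(** The distance is of order [expR (- (rate * t))], so a factor [expR (xi * t)] leaves decay at the
    positive rate [rate - xi]. *)
Lemma exp_attracts_below_closure_E0 : exp_attracts_below I S rate (closure E0).
Proof.
move=> xi /andP[xi0 xir] G bG; have [t0 [C [C0 Gt]]] := E0_exp_near bG.
apply: time_cvg0 => [t|e e0].
  by rewrite mule_ge0 ?hdist_ge0// lee_fin expR_ge0.
have rxi : 0 < rate - xi by rewrite subr_gt0.
exists (Num.max t0 (ln (C / e) / (rate - xi) + 1)) => t It.
rewrite ge_max => /andP[t0t rt].
have Gd : (hdist (S t @` G) (closure E0) <= (C * expR (- (rate * t)))%:E)%E.
  apply: hdist_le => [|_ [x Gx <-]]; first by rewrite mulr_ge0 ?expR_ge0 ?ltW.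
  have [y E0y xy] := Gt t x It t0t Gx.
  by exists y => //; exact: subset_closure.
apply: (@le_trans _ _ ((expR (xi * t))%:E * (C * expR (- (rate * t)))%:E)%E).
  by apply: lee_wpmul2l => //; rewrite lee_fin expR_ge0.
rewrite -EFinM lee_fin mulrCA -expRD.
have -> : xi * t + - (rate * t) = - ((rate - xi) * t) by ring.
by rewrite ltW// exp_decay// (lt_le_trans _ rt)// ltrDl.
Qed.

Lemma E0_nonempty : E0 !=set0.
Proof.
have [x Bx] := B0.
have /(Wnet (leqnn k1))[y yW _] : SB_ k1 (S (k1%:R * T) x) by exists x.
by exists y, 0%N.
Qed.

Local Notation A := (omega_limit I S (closure E0)).

Lemma closure_E0_nonempty : closure E0 !=set0.
Proof. by have [x E0x] := E0_nonempty; exists x; exact: subset_closure. Qed.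

Lemma global_attractor_E0 : global_attractor I S A.
Proof.
apply: global_attractor_omega_limit => //.
- exact: compact_closure_E0.
- exact: attracts_closure_E0.
- exact: closure_E0_nonempty.
Qed.

Lemma attractor_sub_closure_E0 : A `<=` closure E0.
Proof.
apply: (omega_limit_sub hI compact_closure_E0 attracts_closure_E0).
exact: compact_bounded_metric compact_closure_E0.
Qed.

(** The bounded set [A] is its own image at every time, in particular at a time when [B] has
    absorbed it. *)
Lemma attractor_sub_absorbing : A `<=` B.
Proof.
have [_ cA invA _] := global_attractor_E0.
have [t It At] := absB (compact_bounded_metric cA).
by rewrite -(invA t It); exact: At.
Qed.

(* A point of the closure outside [E0] is not a limit of the finitely many
   early centers, hence it is a limit of late ones, which lie in [S(kT) B]
   with [k] large. *)
Lemma closure_E0_split : closure E0 = A `|` E0.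
Proof.
apply/seteqP; split => [x clx|x [|]]; last 2 first.
- exact: attractor_sub_closure_E0.
- exact: subset_closure.
have [E0x|nE0x] := pselect (E0 x); [by right|left].
have BA := omega_limit_maximal hI hSac compact_closure_E0 attracts_closure_E0 bB.
apply: (BA x).
apply/(omega_limitP _ hI) => s e e0.
pose m := (Num.truncn `|s / T|).+1.
have sm : s <= m%:R * T.
  by rewrite -ler_pdivrMr// (le_trans (ler_norm _))// ltW// -truncn_lt_nat.
have : closure ([set` early_centers m] `|`
  [set x | exists2 n, (m <= n)%N & x \in centers n]) x.
  by apply: closure_subset clx; exact: E0_split.
rewrite closureU => -[|/closure_mdistP/(_ e e0)[y [n mn yn] xy]].
  have accV : accessible_space V := hausdorff_accessible (@metric_hausdorff R V).
  have closed_early :=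
    accessible_finite_set_closed.1 accV _ (finite_seq (early_centers m)).
  rewrite -(closure_id _).1//.
  by move=> /mem_early_centers[n _ xn]; exfalso; apply: nE0x; exists n.
have [z Bz zy] := centers_image yn.
exists ((k1 + n)%:R * T), z; split => //; first exact: timeMn.
  by rewrite (le_trans sm)// ler_pM2r// ler_nat (leq_trans mn)// leq_addl.
by rewrite zy.
Qed.

(** By invariance [A] is contained in [S(mT) B] for every [m], so the closure is covered by the
    balls around [W m] and the early centers. Their number grows like [g^m] for any [g > h], and [g]
    then tends to [h]. *)
Lemma fractal_dim_closure_E0 :
  (fractal_dim (closure E0) <= elog q^-1 h%:E)%E.
Proof.
have /andP[q0 q1] := q01; have h0 : 0 < h by exact: lt_le_trans h1.
have l0 : 0 < ln q^-1 by rewrite ln_gt0// invf_gt1.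
rewrite /elog lne_EFin// -EFinM; apply/lee_addgt0Pr => d d0.
(* This is [h q^(-d)]: its logarithm to base [1/q] exceeds that of [h] by exactly [d], and [g > 1]
   even when [h = 1]. *)
pose g := h * expR (d * ln q^-1).
have hg : h < g by rewrite /g ltr_pMr// expR_gt1 mulr_gt0.
have g1 : 1 < g by exact: le_lt_trans hg.
have [C C0 sC] := size_W_early (ltW hg) g1.
have -> : ((ln h / ln q^-1)%:E + d%:E)%E = (ln g / ln q^-1)%:E.
  rewrite /g lnM ?posrE ?expR_gt0// expRK -EFinD; congr EFin; field.
  by rewrite gt_eqF.
apply: (@fractal_dim_geometric _ _ _ a C q g k1) => //; first exact: ltW.
move=> m k1m.
have Ksub : closure E0 `<=` SB_ m `|` E0.
  rewrite closure_E0_split; apply: setSU => x Ax.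
  have [_ _ invA _] := global_attractor_E0.
  have ImT := timeMn hI m hTI.
  move: Ax; rewrite -{1}(invA _ ImT) => -[y Ay <-].
  by exists y => //; exact: attractor_sub_absorbing.
apply: le_trans (covering_number_net_le _ (W_early_net k1m Ksub)) _.
  by move=> x /(W_early_E0 k1m) E0x; exact: subset_closure.
by rewrite lee_fin; exact: sC.
Qed.

Lemma discrete_exp_attractor_closure_E0 : discrete_exp_attractor I S T (closure E0).
Proof.
have h0 : 0 < h by exact: lt_le_trans h1.
split.
- exact: closure_E0_nonempty.
- exact: compact_closure_E0.
- have [_ _ invA _] := global_attractor_E0.
  rewrite closure_E0_split image_setU invA//; apply: setUS.
  exact: E0_positively_invariant.
- apply: le_lt_trans fractal_dim_closure_E0 _.
  by rewrite /elog lne_EFin// -EFinM ltry.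
- exists (rate / 2); first by rewrite divr_gt0// rate_gt0.
  apply: exp_attracts_below_closure_E0.
  have r0 := rate_gt0.
  by rewrite divr_gt0//= ltr_pdivrMr// ltr_pMr// ltr1n.
Qed.

Lemma exponential_attractor_E0 :
  [/\ countable E0 /\ E0 `<=` B,
      global_attractor I S A,
      A `|` E0 = closure E0 /\ closure E0 `<=` B,
      discrete_exp_attractor I S T (A `|` E0) /\
        exp_attracts_below I S rate (A `|` E0) &
      (fractal_dim (A `|` E0) <= elog q^-1 h%:E)%E].
Proof.
rewrite -closure_E0_split; split.
- by split; [exact: countable_E0|exact: E0_subset].
- exact: global_attractor_E0.
- split => //; rewrite closure_E0_split => x [Ax|E0x].
    exact: attractor_sub_absorbing.
  exact: E0_subset.
- split; first exact: discrete_exp_attractor_closure_E0.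
  exact: exp_attracts_below_closure_E0.
- exact: fractal_dim_closure_E0.
Qed.

End AttractorOfCovering.

(** * Equivalence of the two existence statements, with the explicit attractor *)

Theorem theorem2p6 (R : realType) (V : metricType R) (I : set R)
    (S : R -> V -> V) (T : R)
    (hV : complete_metric V) (hI : is_time_set I)
    (hS : is_semigroup I S) (hSac : asymptotically_closed I S)
    (hTI : I T) (hT : 0 < T) :
  ((exists M0 : set V, discrete_exp_attractor I S T M0) <->
   (exists B : set V,
      [/\ B !=set0, bounded_metric B, absorbing I S B &
          exists (k0 : nat) (a b q h : R),
            [/\ (0 < k0)%N, 0 < a /\ 0 < b, 0 < q < 1, 1 <= h &
                covering_condition S T B k0 a b q h]])) /\
  (forall (B : set V) (k0 : nat) (a b q h : R),
     B !=set0 -> bounded_metric B -> absorbing I S B ->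
     (0 < k0)%N -> 0 < a -> 0 < b -> 0 < q < 1 -> 1 <= h ->
     covering_condition S T B k0 a b q h ->
     exists E0 : set V,
       let A := omega_limit I S (closure E0) in
       let M0 := A `|` E0 in
       [/\ countable E0 /\ E0 `<=` B,
           global_attractor I S A,
           M0 = closure E0 /\ closure E0 `<=` B,
           discrete_exp_attractor I S T M0 /\
             exp_attracts_below I S (T^-1 * ln q^-1) M0 &
           (fractal_dim M0 <= elog q^-1 h%:E)%E]).
Proof.
have covering_attractor B k0 a b q h :
    B !=set0 -> bounded_metric B -> absorbing I S B ->
    (0 < k0)%N -> 0 < a -> 0 < b -> 0 < q < 1 -> 1 <= h ->
    covering_condition S T B k0 a b q h ->
    exists E : set V,
      let A := omega_limit I S (closure E) in
      let M0 := A `|` E in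
      [/\ countable E /\ E `<=` B,
          global_attractor I S A,
          M0 = closure E /\ closure E `<=` B,
          discrete_exp_attractor I S T M0 /\
            exp_attracts_below I S (T^-1 * ln q^-1) M0 &
          (fractal_dim M0 <= elog q^-1 h%:E)%E].
  move=> B0 bB absB _ a0 b0 q01 h1 cov.
  have [tB ItB Bt] := absB B bB.
  (* From [k1] on the covering condition is available, and [k1 T] is past the time at which [B]
     absorbs itself. *)
  pose k1 := maxn k0 (Num.truncn `|tB / T|).+1.
  have SB t : I t -> k1%:R * T <= t -> S t @` B `<=` B.
    move=> It k1t; apply: (Bt t It); rewrite (le_trans _ k1t)//.
    rewrite -ler_pdivrMr// (le_trans (ler_norm _))//.
    rewrite (@le_trans _ _ (Num.truncn `|tB / T|).+1%:R)//.
      by rewrite ltW// -truncn_lt_nat.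
    by rewrite ler_nat leq_maxr.
  (* The nets are chosen for all [k] at once, with the empty list as default below [k1]. *)
  have /choice[W WP] (k : nat) : exists s : seq V, (k1 <= k)%N ->
      [/\ (size s)%:R <= b * h ^+ k, {in s, forall x, (S (k%:R * T) @` B) x} &
          eps_net s (a * q ^+ k) (S (k%:R * T) @` B)].
    have [k1k|] := leqP k1 k; last by exists [::].
    have k0k : (k0 <= k)%N by rewrite (leq_trans _ k1k)// leq_maxl.
    by have [s sP] := covering_number_le_net (cov k k0k); exists s.
  have Wsize k : (k1 <= k)%N -> (size (W k))%:R <= b * h ^+ k by case/WP.
  have WB k x : (k1 <= k)%N -> x \in W k -> (S (k%:R * T) @` B) x.
    by case/WP => _ + _; exact.
  have Wnet k : (k1 <= k)%N -> eps_net (W k) (a * q ^+ k) (S (k%:R * T) @` B).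
    by case/WP.
  exists (E0 S T k1 W).
  exact: (exponential_attractor_E0 hV hI hS hSac hTI hT B0 bB absB a0 b0 q01 h1
    SB Wsize WB Wnet).
split; last exact: covering_attractor.
split; first by case=> M0; exact: covering_of_attractor.
move=> [B [B0 bB absB [k0 [a [b [q [h [k00 [a0 b0] q01 h1 cov]]]]]]]].
have [E [_ _ _ [expE _] _]] :=
  covering_attractor B k0 a b q h B0 bB absB k00 a0 b0 q01 h1 cov.
by exists (omega_limit I S (closure E) `|` E).
Qed.
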